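(* Let $K$ be a field, let $I\subset S=K[x_1,\ldots,x_n]$ be a non-zero monomial ideal, let $c=\mathrm{indeg}(I)$ and let $d=\max\{\deg(u) : u\in\mathcal{G}(I)\}$. Let $i\ge 0$ and $j$ be integers. (i) If $\beta^K_{i,j}(I)\neq 0$, then $i+c\leq j\leq d(i+1)$. (ii) If $I$ is a square-free monomial ideal and $\beta^K_{i,j}(I)\neq 0$, then $i+c\leq j\leq \min\{n, d(i+1)\}$.
   Context: $S$ has the standard grading. $\mathcal{G}(I)$ denotes the unique minimal set of monomial generators of a monomial ideal $I$. The graded Betti numbers of a finitely generated graded $S$-module $M$ are $\beta^K_{i,j}(M)=\dim_K\mathrm{Tor}^S_i(K,M)_j$; here $I$ itself (not $S/I$) is the module. The initial degree is $\mathrm{indeg}(M)=\inf\{i : M_i\neq 0\}$. *)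

(* Defs.v *)
From mathcomp Require Import all_boot all_order all_algebra.
From mathcomp Require Export mpoly.

Set Implicit Arguments.
Unset Strict Implicit.
Unset Printing Implicit Defensive.

Import GRing.Theory Num.Theory.
Local Open Scope ring_scope.

Section MonomialIdeals.

Variables (K : fieldType) (n : nat).
Implicit Types (I : {mpoly K[n]} -> Prop) (A : 'X_{1..n} -> Prop).

Definition monomial_span A (f : {mpoly K[n]}) : Prop :=
  exists s : seq ({mpoly K[n]} * 'X_{1..n}),
    (forall t, t \in s -> A t.2) /\ f = \sum_(t <- s) t.1 * 'X_[t.2].

Definition generated_by I A : Prop := forall f, I f <-> monomial_span A f.

Definition monomial_ideal I : Prop := exists A, generated_by I A.

Definition squarefree_monomial (u : 'X_{1..n}) : Prop :=
  forall k : 'I_n, (u k <= 1)%N.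

Definition squarefree_monomial_ideal I : Prop :=
  exists A, (forall u, A u -> squarefree_monomial u) /\ generated_by I A.

(* A sequence stands here for the set of its members; minimality is with
   respect to inclusion of generating sets. *)
Definition minimal_monomial_generators I (G : seq 'X_{1..n}) : Prop :=
  generated_by I (fun u => u \in G) /\
  forall A, (forall u, A u -> u \in G) -> generated_by I A ->
    forall u, u \in G -> A u.

Definition nonzero_ideal I : Prop := exists f, I f /\ f != 0.

Definition graded_piece_nonzero I (k : nat) : Prop :=
  exists f, [/\ I f, f != 0 & f \is k.-homog].

Definition is_indeg I (c : nat) : Prop :=
  graded_piece_nonzero I c /\ forall k, graded_piece_nonzero I k -> (c <= k)%N.

End MonomialIdeals.

(* The zero polynomial is homogeneous of every degree, and the only
   homogeneous polynomial of negative degree. *)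
Definition homogz (K : fieldType) (n : nat) (e : int) (f : {mpoly K[n]}) : bool :=
  if e is Posz k then f \is k.-homog else f == 0.

(* F_p = \bigoplus_a S(- fdeg p a), with a homogeneous basis indexed by
   'I_(frank p).  Elements of F_p are row vectors and maps act by right
   multiplication: v |-> v *m fdiff p is F_{p+1} -> F_p, and v |-> v *m faug is
   the augmentation F_0 -> S.  That consecutive maps compose to 0 is part of
   is_resolution below. *)
Record graded_free_seq (K : fieldType) (n : nat) := GradedFreeSeq {
  frank : nat -> nat;
  fdeg  : forall p, 'I_(frank p) -> int;
  fdiff : forall p, 'M[{mpoly K[n]}]_(frank p.+1, frank p);
  faug  : 'cV[{mpoly K[n]}]_(frank 0);
  fdiff_homog : forall p a b, homogz (fdeg a - fdeg b) (fdiff p a b);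
  faug_homog : forall a, homogz (fdeg a) (faug a 0)
}.

Section GradedTor.

Variables (K : fieldType) (n : nat).
Implicit Types (F : graded_free_seq K n) (I : {mpoly K[n]} -> Prop).

Definition is_resolution F I : Prop :=
  [/\ forall f, I f <-> exists v : 'rV_(frank F 0), f = (v *m faug F) 0 0,
      forall v : 'rV_(frank F 0),
        v *m faug F = 0 <-> exists w, v = w *m fdiff F 0
    & forall p (v : 'rV_(frank F p.+1)),
        v *m fdiff F p = 0 <-> exists w, v = w *m fdiff F p.+1].

(* K is S / (x_1, ..., x_n), so K \otimes_S F_p is K^(frank p) and the tensored
   differential keeps the constant terms of the entries. *)
Definition bar_diff F p : 'M[K]_(frank F p.+1, frank F p) :=
  map_mx (mcoeff 0%MM) (fdiff F p).

Definition tor_cycles F i : 'M[K]_(frank F i) :=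
  match i return 'M[K]_(frank F i) with
  | 0%N => 1%:M
  | p.+1 => kermx (bar_diff F p)
  end.

Definition degree_part F i (j : int) : 'M[K]_(frank F i) :=
  diag_mx (\row_a (fdeg a == j)%:R).

(* dim_K H_i(K \otimes_S F)_j.  The truncated subtraction is exact when F is a
   resolution, since boundaries are then contained in cycles. *)
Definition tor_dim F i (j : int) : nat :=
  (\rank (tor_cycles F i :&: degree_part F i j)%MS -
   \rank (bar_diff F i :&: degree_part F i j)%MS)%N.

(* b = dim_K Tor_i^S(K, I)_j.  Tor does not depend on the resolution, and finite
   ranks suffice because S is Noetherian. *)
Definition is_graded_betti I (i : nat) (j : int) (b : nat) : Prop :=
  exists F, is_resolution F I /\ b = tor_dim F i j.

End GradedTor.

(* Main.v *)
(** Tor_i(K, I)_j is the homology of the double complex of a free resolution F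
    of I tensored with the Koszul complex of x_1, ..., x_n.  The Koszul complex
    of S is contractible away from K, so a zigzag carries a cycle of the
    reduction of F_i in degree j to a Koszul cycle with coefficients in I, of
    exterior degree i and total degree j; once the latter is a boundary, so is
    the former.
    The coefficients of such a Koszul cycle have degree j - i, so they vanish
    if j < i + c.  It is a boundary if j exceeds the degree of every lcm of
    i + 1 generators: adding the generators of I one at a time, the
    Mayer-Vietoris sequence of I' + (u) reduces the claim for I in exterior
    degree i to I' in the same degree and to the intersection of I' and (u) in
    degree i - 1, which is generated by the lcm(u, v) with v a generator of I'.
    Such an lcm has degree at most d(i + 1), and at most n if it is
    square-free. *)
Require Import Defs.
From mathcomp Require Import all_boot all_order all_algebra.
From HB Require Import structures.
Set Implicit Arguments.
Unset Strict Implicit.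
Unset Printing Implicit Defensive.
Import Order.TTheory GRing.Theory Num.Theory.
Local Open Scope ring_scope.

(** * Coefficients, shifts and homogeneity of polynomials *)

Section Coefficients.

Variables (K : fieldType) (n : nat).
Implicit Types (f g : {mpoly K[n]}) (m u : 'X_{1..n}) (P : pred 'X_{1..n}).

Lemma mcoeffXM u f m :
  ('X_[u] * f)@_m = if (u <= m)%MM then f@_(m - u) else 0.
Proof.
rewrite -[_ * f]commr_mpolyX; case: ifP => [le_um|nle_um].
  by rewrite -{1}(submK le_um) addmC mcoeffMX.
apply: memN_msupp_eq0; rewrite (perm_mem (msuppMX _ _)).
by apply/mapP => -[m' _ eq_m]; rewrite eq_m lem_addr in nle_um.
Qed.

(** Division by a monomial and truncation of the support in one operator: it serves for setting
    variables to zero, for exact quotients, and for projecting onto the monomials of an ideal.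
    Summing below [msize f] suffices, since a shift only lowers degrees. *)
Definition mshift u P f : {mpoly K[n]} :=
  \sum_(m : 'X_{1..n < msize f} | P m) f@_(m + u) *: 'X_[m].

Lemma mcoeff_mshift u P f m :
  (mshift u P f)@_m = if P m then f@_(m + u) else 0.
Proof.
rewrite /mshift big_mkcond /=.
(* [E] is zero outside [P], so the sum can run over all bounded monomials and [mcoeff_mpoly]
   applies. *)
pose E m' := if P m' then f@_(m' + u) else 0.
rewrite (eq_bigr (fun m' : 'X_{1..n < msize f} => E m' *: 'X_[m'])); last first.
  by move=> m' _; rewrite /E; case: ifP => // _; rewrite scale0r.
have [lt_mf|le_fm] := ltnP (mdeg m) (msize f).
  by rewrite mcoeff_mpoly.
rewrite raddf_sum big1 => [|m' _] /=.
  case: ifP => // _; apply/esym/memN_msupp_eq0/msize_mdeg_ge.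
  by rewrite (leq_trans le_fm) // mdegD leq_addr.
rewrite mcoeffZ mcoeffX; case: eqP => [eq_m|]; last by rewrite mulr0.
by have := bmdeg m'; rewrite eq_m ltnNge le_fm.
Qed.

Fact mshift_is_additive u P : zmod_morphism (mshift u P).
Proof.
move=> f g; apply/mpolyP => m; rewrite !(mcoeff_mshift, mcoeffB).
by case: ifP => // _; rewrite subr0.
Qed.
HB.instance Definition _ u P :=
  GRing.isZmodMorphism.Build _ _ (mshift u P) (mshift_is_additive u P).

Lemma homogzP e f :
  reflect (forall m, f@_m != 0 -> (mdeg m)%:Z = e) (homogz e f).
Proof.
case: e => k /=; last first.
  apply: (iffP eqP) => [-> m|f0]; first by rewrite mcoeff0 eqxx.
  by apply/mpolyP => m; rewrite mcoeff0; apply/eqP; apply: contraT => /f0.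
rewrite dhomogE; apply: (iffP allP) => fP m; have := fP m.
  by rewrite mcoeff_msupp => {}fP /fP /eqP->.
by rewrite mcoeff_msupp => {}fP /fP [<-] /=.
Qed.

Lemma homogz0 e : homogz e (0 : {mpoly K[n]}).
Proof. by apply/homogzP => m; rewrite mcoeff0 eqxx. Qed.

Lemma homogzD e f g : homogz e f -> homogz e g -> homogz e (f + g).
Proof.
by case: e => k /=; [exact: dhomogD | move=> /eqP-> /eqP->; rewrite addr0].
Qed.

Lemma homogzN e f : homogz e f -> homogz e (- f).
Proof.
by move=> /homogzP hf; apply/homogzP => m; rewrite mcoeffN oppr_eq0 => /hf.
Qed.

Lemma homogz_sum (J : Type) (r : seq J) (Q : pred J) (F : J -> {mpoly K[n]}) e :
  (forall x, Q x -> homogz e (F x)) -> homogz e (\sum_(x <- r | Q x) F x).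
Proof.
move=> hF; apply: (big_ind (fun f => homogz e f)) => //; first exact: homogz0.
by move=> f g; exact: homogzD.
Qed.

Lemma homogzM e e' f g : homogz e f -> homogz e' g -> homogz (e + e') (f * g).
Proof.
case: e => k /=; last by move=> /eqP-> _; rewrite mul0r homogz0.
case: e' => k' /=; last by move=> _ /eqP->; rewrite mulr0 homogz0.
exact: dhomogM.
Qed.

Lemma homogzXU (v : 'I_n) : homogz 1 ('X_v : {mpoly K[n]}).
Proof. by rewrite /= dhomogX /= mdeg1. Qed.

Lemma homogz_sign e k f : homogz e f -> homogz e ((-1) ^+ k * f).
Proof.
move=> hf; rewrite -signr_odd.
by case: (odd k); rewrite ?expr0 ?expr1 ?mul1r // mulN1r; exact: homogzN.
Qed.

Lemma homogz_mshift u P e f :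
  homogz e f -> homogz (e - (mdeg u)%:Z) (mshift u P f).
Proof.
move=> /homogzP hf; apply/homogzP => m; rewrite mcoeff_mshift.
case: ifP => [_ /hf <-|]; last by rewrite eqxx.
by rewrite mdegD PoszD addrK.
Qed.

Lemma homogz_const_eq0 e f : homogz e f -> e != 0 -> f@_0%MM = 0.
Proof.
move=> /homogzP hf nz_e; apply/eqP; apply: contraNT nz_e => /hf <-.
by rewrite mdeg0.
Qed.

End Coefficients.

(** * The Koszul differential, and division by a variable *)

Section KoszulComplex.

Variables (K : fieldType) (n : nat).
Local Notation S := {mpoly K[n]}.
Implicit Types (A B : {set 'I_n}) (v w : 'I_n).

Definition kcoef v A : S := (-1) ^+ #|[set w in A | w < v]%N| * 'X_v.

(* A family [k] stands for [\sum_A k A (x) e_A] in [V (x) \Lambda K^n]. *)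
Definition koszul (V : lmodType S) (k : {set 'I_n} -> V) A : V :=
  \sum_(v | v \notin A) kcoef v A *: k (v |: A).

(** Adding the smaller of the two indices to [A] flips the sign attached to the other; adding the
    larger one changes nothing. So exactly one side picks up a sign. *)
Lemma kcoef_swap v w A : v \notin A -> w \notin A -> v != w ->
  kcoef v A * kcoef w (v |: A) = - (kcoef w A * kcoef v (w |: A)).
Proof.
have sgU x y : x \notin A -> kcoef y (x |: A) =
    (if (x < y)%N then -1 else 1) * kcoef y A.
  move=> xA; rewrite /kcoef mulrA; congr (_ * _); case: ifP => lt_xy.
    rewrite -exprS; congr (_ ^+ _).
    have -> : [set z in x |: A | (z < y)%N] = x |: [set z in A | (z < y)%N].
      by apply/setP => z; rewrite !inE andb_orl; case: eqP => // ->; rewrite lt_xy.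
    by rewrite cardsU1 !inE (negPf xA) add1n.
  rewrite mul1r; congr (_ ^+ #|pred_of_set _|); apply/setP => z; rewrite !inE.
  by case: eqP => // ->; rewrite lt_xy !andbF.
move=> vA wA; rewrite -val_eqE neq_ltn => vw; rewrite !sgU //.
by case/orP: vw => lt; rewrite lt ltnNge (ltnW lt) /= mul1r mulN1r mulrN ?opprK
  [in RHS]mulrC.
Qed.

(** The double sum splits into the pairs with [v < w] and those with [w < v], which cancel by
    [kcoef_swap]. *)
Lemma koszul_koszul (V : lmodType S) (k : {set 'I_n} -> V) A :
  koszul (koszul k) A = 0.
Proof.
pose F v w : V := (kcoef v A * kcoef w (v |: A)) *: k (w |: (v |: A)).
pose Q v w := [&& v \notin A, w \notin A & (v < w)%N].
have FN v w : Q v w -> F v w = - F w v.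
  move=> /and3P[vA wA vw]; rewrite /F kcoef_swap // ?scaleNr ?(setUCA [set w]) //.
  by rewrite -val_eqE neq_ltn vw.
rewrite [LHS](_ : _ = \sum_v \sum_(w | Q v w) F v w
                     + \sum_v \sum_(w | Q w v) F v w).
  rewrite [X in _ + X](exchange_big_dep xpredT) //= -big_split big1 //= => v _.
  by rewrite -big_split big1 //= => w /FN ->; rewrite addNr.
rewrite -big_split /= /koszul big_mkcond; apply: eq_bigr => v _ /=.
case: ifPn => [vA|/negPn vA]; last first.
  by rewrite !big1 ?addr0 // => w /and3P[]; rewrite vA.
rewrite scaler_sumr (bigID (fun w => v < w)%N) /=; congr (_ + _).
  apply: eq_big => [w|w _]; last by rewrite scalerA.
  rewrite /Q vA !inE negb_or; case: ltnP => [vw|]; rewrite ?andbF ?andbT //=.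
  by rewrite -val_eqE neq_ltn vw orbT.
apply: eq_big => [w|w _]; last by rewrite scalerA.
rewrite /Q vA !inE negb_or -leqNgt leq_eqVlt val_eqE.
have [->|nvw] := eqVneq w v; first by rewrite ltnn !andbF.
by [].
Qed.

Lemma koszul_linear (V W : lmodType S) (f : {linear V -> W}) k A :
  f (koszul k A) = koszul (f \o k) A.
Proof. by rewrite linear_sum; apply: eq_bigr => v _; rewrite linearZ. Qed.

Lemma eq_koszul (V : lmodType S) (k k' : {set 'I_n} -> V) A :
  k =1 k' -> koszul k A = koszul k' A.
Proof. by move=> eqk; apply: eq_bigr => v _; rewrite eqk. Qed.

Lemma koszulB (V : lmodType S) (k k' : {set 'I_n} -> V) A :
  koszul (fun B => k B - k' B) A = koszul k A - koszul k' A.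
Proof. by rewrite -sumrB; apply: eq_bigr => v _; rewrite scalerBr. Qed.

Lemma koszulD (V : lmodType S) (k k' : {set 'I_n} -> V) A :
  koszul (fun B => k B + k' B) A = koszul k A + koszul k' A.
Proof. by rewrite -big_split; apply: eq_bigr => v _; rewrite scalerDr. Qed.

Definition in_card (V : zmodType) i (k : {set 'I_n} -> V) :=
  forall A, #|A| != i -> k A = 0.

Lemma koszul_in_card (V : lmodType S) i (k : {set 'I_n} -> V) :
  in_card i.+1 k -> in_card i (koszul k).
Proof.
move=> k_i A Ai; rewrite /koszul big1 // => v vA.
by rewrite k_i ?scaler0 // cardsU1 vA add1n eqSS.
Qed.

Lemma koszul_in_card0 (V : lmodType S) (k : {set 'I_n} -> V) A :
  in_card 0 k -> koszul k A = 0.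
Proof.
move=> k_0; rewrite /koszul big1 // => v vA.
by rewrite k_0 ?scaler0 // cardsU1 vA.
Qed.

Lemma koszul_const0 r (k : {set 'I_n} -> 'rV[S]_r) A a :
  (koszul k A 0 a)@_0%MM = 0.
Proof.
rewrite summxE raddf_sum big1 //= => v _.
by rewrite mxE !rmorphM /= mcoeffX mnm1_eq0 mulr0 mul0r.
Qed.

Lemma homogz_kcoef v A : homogz 1 (kcoef v A).
Proof. exact/homogz_sign/homogzXU. Qed.

(** Total degree [j], where [e_A] has degree the size of [A]. *)
Definition homog_family j (k : {set 'I_n} -> S) :=
  forall A, homogz (j - #|A|%:Z) (k A).

Lemma homog_koszul j (k : {set 'I_n} -> S) :
  homog_family j k -> homog_family j (koszul (k : _ -> S^o)).
Proof.
move=> hk A; apply: homogz_sum => v vA.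
have -> : j - #|A|%:Z = 1 + (j - #|v |: A|%:Z).
  by rewrite cardsU1 vA PoszD opprD addrCA; congr (_ + _); exact/esym/addNKr.
exact/homogzM/hk/homogz_kcoef.
Qed.

Definition free_below b (m : 'X_{1..n}) := [forall w : 'I_n, (w < b)%N ==> (m w == 0%N)].

Lemma free_belowP b (m : 'X_{1..n}) :
  reflect (forall w : 'I_n, (w < b)%N -> m w = 0%N) (free_below b m).
Proof.
apply: (iffP forallP) => mP w; first by move=> wb; apply/eqP/(implyP (mP w)).
by apply/implyP => /mP ->.
Qed.

(* [restr_from b f] is the image of f under [x_w := 0] for all [w < b], and
   [divX v f] the quotient by [x_v] of the part of [restr_from v f] divisible
   by [x_v]. *)
Definition restr_from b : S -> S := mshift 0%MM (free_below b).
Definition divX v : S -> S := mshift U_(v)%MM (free_below v).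
HB.instance Definition _ v := GRing.Additive.on (divX v).

Lemma mcoeff_restr_from b (f : S) m :
  (restr_from b f)@_m = if free_below b m then f@_m else 0.
Proof. by rewrite mcoeff_mshift addm0. Qed.

Lemma mcoeff_divX v (f : S) m :
  (divX v f)@_m = if free_below v m then f@_(m + U_(v)) else 0.
Proof. exact: mcoeff_mshift. Qed.

(** A monomial involving a variable before [b] occurs in exactly one summand, that of its least
    variable; the others make up the restriction. *)
Lemma restr_from_decomp (b : nat) (f : S) :
  f = restr_from b f + \sum_(w : 'I_n | (w < b)%N) 'X_w * divX w f.
Proof.
apply/mpolyP => m; rewrite mcoeffD mcoeff_restr_from raddf_sum /=.
have coefX w : ('X_w * divX w f)@_m =
    if (m w != 0)%N && free_below w m then f@_m else 0.
  rewrite mcoeffXM lep1mP mcoeff_divX; case: eqP => //= nz.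
  rewrite submK ?lep1mP; last exact/eqP.
  congr (if _ then _ else _); apply/free_belowP/free_belowP => mw z lt_z;
    have := mw z lt_z; rewrite mnmBE mnm1E => <-;
    by rewrite -val_eqE gtn_eqF // subn0.
rewrite (eq_bigr _ (fun w _ => coefX w)).
case: ifPn => [/free_belowP m0|].
  by rewrite big1 ?addr0 // => w /m0 ->.
rewrite negb_forall => /existsP[w0]; rewrite negb_imply => /andP[lt_w0 nz_w0].
have: (m w0 != 0)%N && (w0 < b)%N by rewrite nz_w0.
case/(@arg_minnP _ w0 (fun w : 'I_n => (m w != 0%N) && (w < b)%N) (@nat_of_ord n)).
move=> w /andP[nz_w lt_w] w_min.
have w_free : free_below w m.
  apply/free_belowP => z lt_z; apply/eqP; apply: contraTT (lt_z) => nz_z.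
  by rewrite -leqNgt w_min // nz_z (ltn_trans lt_z lt_w).
rewrite add0r (bigD1 w) //= nz_w w_free big1 ?addr0 // => z /andP[_ nzw].
case: ifP => // /andP[nz_z /free_belowP z_free].
have := neq_ltn w z; rewrite val_eqE eq_sym nzw => /esym/orP[] lt.
  by rewrite (z_free w lt) in nz_w.
by move/free_belowP: w_free => /(_ z lt) z0; rewrite z0 in nz_z.
Qed.

Lemma restr_from_full (f : S) : restr_from n f = (f@_0%MM)%:MP.
Proof.
apply/mpolyP => m; rewrite mcoeff_restr_from mcoeffC.
have [->|nz_m] := eqVneq m 0%MM.
  by rewrite mulr1; case: free_belowP => // -[] w _; rewrite mnm0E.
rewrite mulr0; case: free_belowP => // m0; case/eqP: nz_m.
by apply/mnmP => w; rewrite mnm0E m0.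
Qed.

Lemma divX_lt v w (f : S) : (w < v)%N -> divX v ('X_w * f) = 0.
Proof.
move=> wv; apply/mpolyP => m; rewrite mcoeff_divX mcoeff0.
case: free_belowP => // m0; rewrite mcoeffXM lep1mP mnmDE m0 //.
have /negPf nvw : v != w by rewrite -val_eqE neq_ltn wv orbT.
by rewrite mnm1E nvw.
Qed.

Lemma divXX v (f : S) : divX v ('X_v * f) = restr_from v f.
Proof.
apply/mpolyP => m; rewrite mcoeff_divX mcoeff_restr_from mcoeffXM lem_addl.
by rewrite addmK.
Qed.

Lemma divX_gt v w (f : S) : (v < w)%N -> divX v ('X_w * f) = 'X_w * divX v f.
Proof.
move=> vw; apply/mpolyP => m; rewrite mcoeffXM !mcoeff_divX mcoeffXM !lep1mP.
have -> : (m + U_(v))%MM w = m w.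
  by rewrite mnmDE mnm1E -val_eqE ltn_eqF // addn0.
have -> : free_below v (m - U_(w)) = free_below v m.
  apply/free_belowP/free_belowP => m0 z lt_z; have := m0 z lt_z;
    rewrite mnmBE mnm1E -val_eqE gtn_eqF ?subn0 //; exact: ltn_trans vw.
case: eqP => [_|/eqP nz]; first by rewrite if_same.
by rewrite /= [(m - _ + _)%MM]addmC addmBA ?lep1mP //
  [(U_(v) + _)%MM]addmC.
Qed.

End KoszulComplex.

(** * A contracting homotopy of the Koszul complex of [S] *)

Section KoszulHomotopy.

Variables (K : fieldType) (n : nat).
Local Notation S := {mpoly K[n]}.
Implicit Types (A B : {set 'I_n}) (v w : 'I_n) (k : {set 'I_n} -> S).

(* The contraction is [x^m e_A |-> x^(m - v) e_(v |: A)] when the least element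
   [v] of [A] and the support of [m] is not in [A], and [0] otherwise. *)
Definition kcontract k A : S :=
  \sum_(v | (v \in A) && [forall w in A, (v <= w)%N]) divX v (k (A :\ v)).

Lemma kcontract_min k A v :
  v \in A -> {in A, forall w, (v <= w)%N} -> kcontract k A = divX v (k (A :\ v)).
Proof.
move=> vA v_min; apply: big_pred1 => w; apply/andP/eqP => [[wA /forall_inP wm]|->].
  by apply/val_inj/anti_leq; rewrite v_min ?wm.
by split=> //; apply/forall_inP.
Qed.

Lemma kcoef_min v A : {in A, forall w, (v <= w)%N} -> kcoef K v A = 'X_v.
Proof.
move=> v_min; rewrite /kcoef [X in #|pred_of_set X|](_ : _ = set0) ?cards0 ?mul1r //.
apply/setP => w; rewrite !inE; apply/negbTE/negP => /andP[/v_min le_vw].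
by rewrite ltnNge le_vw.
Qed.

Lemma divX_kcoef v w A (f : S) : v \notin A -> (v < w)%N ->
  divX v (kcoef K w A * f) = kcoef K w A * divX v f.
Proof. by move=> vA lt_vw; rewrite /kcoef -!mulrA raddfMsign /= divX_gt. Qed.

(** The term [w = v] of the differential gives the restriction, the terms [w < v] are killed by
    [divX v], and those with [w > v] return with the opposite sign in [koszul_kcontract]. *)
Lemma kcontract_koszul k A v : v \in A -> {in A, forall w, (v <= w)%N} ->
  kcontract (koszul (k : _ -> S^o)) A = restr_from v (k A) +
    \sum_(w | (w \notin A) && (v < w)%N)
      kcoef K w (A :\ v) * divX v (k (w |: (A :\ v))).
Proof.
move=> vA v_min; rewrite (kcontract_min _ vA v_min) raddf_sum (bigD1 v) /=;
  last by rewrite !inE eqxx.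
congr (_ + _).
  rewrite setD1K // kcoef_min ?divXX // => w /setD1P[_]; exact: v_min.
rewrite (bigID (fun w => (v < w)%N)) /= [X in _ + X]big1 ?addr0.
  apply: eq_big => [w|w /andP[_ vw]]; last by rewrite -divX_kcoef // !inE eqxx.
  rewrite !inE negb_and negbK; case: (eqVneq w v) => [->|]; first by rewrite ltnn !andbF.
  by rewrite andbT.
move=> w /andP[/andP[_ nwv]]; rewrite -leqNgt => le_wv.
by rewrite /GRing.scale /= /kcoef -mulrA raddfMsign /= divX_lt ?mulr0 // ltn_neqAle nwv.
Qed.

(** If [w < v], then [w] is the least element of [w |: A], and contracting divides by it. If
    [w > v], the least element is still [v], and removing it changes the sign of the coefficient of
    [w]. *)
Lemma koszul_kcontract k A v : v \in A -> {in A, forall w, (v <= w)%N} ->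
  koszul (kcontract k : _ -> S^o) A =
    \sum_(w : 'I_n | (w < v)%N) 'X_w * divX w (k A) -
    \sum_(w | (w \notin A) && (v < w)%N)
      kcoef K w (A :\ v) * divX v (k (w |: (A :\ v))).
Proof.
move=> vA v_min; rewrite /koszul (bigID (fun w => (v < w)%N)) /= addrC.
rewrite -sumrN; congr (_ + _).
  apply: eq_big => [w|w /andP[wA]].
    apply/andP/idP => [[wA]|lt_wv].
      rewrite -leqNgt leq_eqVlt => /orP[/eqP/val_inj wv|//].
      by rewrite wv vA in wA.
    by split; [apply: contraL lt_wv => /v_min; rewrite -leqNgt | rewrite -leqNgt ltnW].
  rewrite -leqNgt => le_wv.
  have w_min: {in A, forall z : 'I_n, (w <= z)%N}.
    by move=> z /v_min; apply: leq_trans.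
  rewrite kcoef_min // (@kcontract_min _ _ w) ?setU11 ?setU1K //.
  by move=> z /setU1P[->|/w_min].
apply: eq_bigr => w /andP[wA lt_vw].
have neq_vw : v != w by rewrite -val_eqE neq_ltn lt_vw.
rewrite (@kcontract_min _ _ v) ?inE ?vA ?orbT //; last first.
  by move=> z /setU1P[->|/v_min //]; exact: ltnW.
have -> : (w |: A) :\ v = w |: (A :\ v).
  apply/setP => z; rewrite !inE; case: (eqVneq z v) => // ->.
  by rewrite (negPf neq_vw).
suff -> : kcoef K w A = - kcoef K w (A :\ v) by exact: mulNr.
rewrite /kcoef (cardsD1 v) !inE vA lt_vw add1n exprS mulN1r mulNr.
congr (- ((-1) ^+ #|pred_of_set _| * _)).
by apply/setP => z; rewrite !inE andbA.
Qed.

(** The sums over [w > v] cancel, leaving [restr_from_decomp] at the least element [v] of [A]. *)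
Lemma koszul_homotopy k A : A != set0 ->
  k A = koszul (kcontract k : _ -> S^o) A + kcontract (koszul (k : _ -> S^o)) A.
Proof.
case/set0Pn => v0 v0A; pose v := [arg min_(v < v0 in A) v : nat].
have [vA v_min] : v \in A /\ {in A, forall w, (v <= w)%N}.
  by rewrite /v; case: arg_minnP => // w wA w_min; split.
rewrite (koszul_kcontract _ vA v_min) (kcontract_koszul _ vA v_min).
by rewrite [X in _ + X]addrC addrA subrK addrC -restr_from_decomp.
Qed.

(** Here every variable contributes, so the decomposition is the one at [n]. The constant term left
    over is the homology [K] in exterior degree 0. *)
Lemma koszul_homotopy0 k :
  k set0 = koszul (kcontract k : _ -> S^o) set0 + ((k set0)@_0%MM)%:MP.
Proof.
rewrite {1}(restr_from_decomp n (k set0)) restr_from_full addrC; congr (_ + _).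
apply: eq_big => [w|w _]; first by rewrite inE ltn_ord.
rewrite kcoef_min => [|z]; last by rewrite inE.
rewrite (@kcontract_min _ _ w) ?setU11 ?setU1K ?inE //.
by move=> z; rewrite !inE orbF => /eqP->.
Qed.

Lemma koszul_exact k : (k set0)@_0%MM = 0 ->
  (forall A, koszul (k : _ -> S^o) A = 0) ->
  forall A, k A = koszul (kcontract k : _ -> S^o) A.
Proof.
move=> k0 dk A; have [->|nzA] := eqVneq A set0.
  by rewrite {1}koszul_homotopy0 k0 mpolyC0 addr0.
rewrite {1}koszul_homotopy // [kcontract _ _]big1 ?addr0 // => v _.
by rewrite dk raddf0.
Qed.

Lemma kcontract_in_card i k : in_card i k -> in_card i.+1 (kcontract k).
Proof.
move=> k_i A Ai; rewrite [LHS]big1 // => v /andP[vA _].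
by rewrite k_i ?raddf0 //; rewrite (cardsD1 v A) vA eqSS in Ai.
Qed.

Lemma homog_kcontract j k : homog_family j k -> homog_family j (kcontract k).
Proof.
move=> hk A; apply: homogz_sum => v /andP[vA _].
have -> : j - #|A|%:Z = (j - #|A :\ v|%:Z) - 1.
  by rewrite (cardsD1 v A) vA PoszD opprD addrCA addrC.
rewrite -[1 in X in homogz X]/(1%N%:Z) -(mdeg1 v).
exact: homogz_mshift.
Qed.

End KoszulHomotopy.

(** * Vanishing of Koszul homology with coefficients in a monomial ideal *)

Section KoszulVanishing.

Variables (K : fieldType) (n : nat).
Local Notation S := {mpoly K[n]}.
Local Notation kz := (@koszul K n S^o).
Implicit Types (A B : {set 'I_n}) (k : {set 'I_n} -> S) (f g : S).
Implicit Types (u m : 'X_{1..n}) (L s : seq 'X_{1..n}) (j : int).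

(* [koszulD] and [koszulB] with the operations of [S] instead of those of [S^o]. *)
Fact kzD k k' A : kz (fun B => k B + k' B) A = (kz k A : S) + (kz k' A : S).
Proof. exact: (@koszulD K n S^o). Qed.

Fact kzB k k' A : kz (fun B => k B - k' B) A = (kz k A : S) - (kz k' A : S).
Proof. exact: (@koszulB K n S^o). Qed.

(** The ideal generated by the monomials of [L], described by supports so that truncating a
    polynomial to some of its monomials is easy to follow. *)
Definition mgen_ideal L f :=
  forall m, f@_m != 0 -> has (fun u => (u <= m)%MM) L.

Lemma mgen_ideal0 L : mgen_ideal L 0.
Proof. by move=> m; rewrite mcoeff0 eqxx. Qed.

Lemma mgen_idealD L f g : mgen_ideal L f -> mgen_ideal L g -> mgen_ideal L (f + g).
Proof.
move=> fL gL m; rewrite mcoeffD; have [->|/fL //] := eqVneq f@_m 0.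
by rewrite add0r => /gL.
Qed.

Lemma mgen_idealN L f : mgen_ideal L f -> mgen_ideal L (- f).
Proof. by move=> fL m; rewrite mcoeffN oppr_eq0 => /fL. Qed.

Lemma mgen_idealM L f g : mgen_ideal L g -> mgen_ideal L (f * g).
Proof.
move=> gL m; rewrite -mcoeff_msupp => /msuppM_le/allpairsP[[m1 m2] /= [_ m2g ->]].
rewrite mcoeff_msupp in m2g; apply: sub_has (gL _ m2g) => u /lepm_trans; apply.
exact: lem_addl.
Qed.

Lemma mgen_ideal_koszul L k A :
  (forall B, mgen_ideal L (k B)) -> mgen_ideal L (kz k A).
Proof.
move=> kL; apply: (big_ind (mgen_ideal L)) => [|f g|v _].
- exact: mgen_ideal0.
- exact: mgen_idealD.
- exact: mgen_idealM.
Qed.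

(* [H_i(I (x) \Lambda K^n)_j = 0] for the Koszul complex. *)
Definition koszul_acyclic (I : S -> Prop) (i : nat) j :=
  forall k, in_card i k -> homog_family j k -> (forall A, I (k A)) ->
    (forall A, kz k A = 0) ->
  exists y, [/\ in_card i.+1 y, homog_family j y, forall A, I (y A)
             & forall A, k A = kz y A].

Lemma eq_koszul_acyclic (I J : S -> Prop) i j :
  (forall f, I f <-> J f) -> koszul_acyclic J i j -> koszul_acyclic I i j.
Proof.
move=> IJ acJ k k_i hk kI dk; have [A|y [y_i hy yJ dy]] := acJ k k_i hk _ dk.
  exact/IJ.
by exists y; split=> // A; apply/IJ.
Qed.

(** Dividing by ['X_[u]] gives a cycle over [S] of total degree [j - mdeg u]. As this is positive,
    the constant term that obstructs exactness vanishes. *)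
Lemma koszul_acyclic_principal u i j :
  (mdeg u)%:Z < j -> koszul_acyclic (mgen_ideal [:: u]) i j.
Proof.
move=> lt_uj k k_i hk kI dk.
pose q A : S := mshift u predT (k A).
have kE A : k A = 'X_[u] * q A.
  apply/mpolyP => m; rewrite mcoeffXM; case: ifP => [le_um|nle_um].
    by rewrite mcoeff_mshift submK.
  apply/eqP; apply: contraFT nle_um => /kI; by rewrite /= orbF.
have qi : in_card i q by move=> A /k_i kA; rewrite /q kA raddf0.
have hq : homog_family (j - (mdeg u)%:Z) q.
  by move=> A; rewrite addrAC; apply: homogz_mshift.
have dq A : kz q A = 0.
  have: 'X_[u] * kz q A = 0.
    rewrite -(dk A) /koszul mulr_sumr; apply: eq_bigr => v _.
    by rewrite kE /GRing.scale /= mulrCA.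
  by move/eqP; rewrite mulf_eq0 -msupp_eq0 msuppX => /eqP.
have q0 : (q set0)@_0%MM = 0.
  apply: homogz_const_eq0 (hq set0) _.
  by rewrite cards0 subr0 subr_eq0 eq_sym lt_eqF.
exists (fun A => 'X_[u] * kcontract q A); split=> A.
- by move/(kcontract_in_card qi) => ->; rewrite mulr0.
- have -> : j - #|A|%:Z = (mdeg u)%:Z + (j - (mdeg u)%:Z - #|A|%:Z).
    by rewrite [j - _ - _]addrAC [RHS]addrC subrK.
  by apply: homogzM; [rewrite /= dhomogX | apply: homog_kcontract].
- move=> m; rewrite mcoeffXM /= orbF; by case: ifP => //; rewrite eqxx.
- rewrite kE (koszul_exact q0 dq) /koszul mulr_sumr; apply: eq_bigr => v _.
  by rewrite /GRing.scale /= mulrCA.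
Qed.

(* Mayer-Vietoris for [I = I' + (u)]: the generators [mlcm u v] with [v] in [L]
   generate [I' \cap (u)]. *)
Lemma koszul_acyclic_cons u L i j :
  koszul_acyclic (mgen_ideal L) i j ->
  koszul_acyclic (mgen_ideal [:: u]) i j ->
  (if i is i'.+1 then koszul_acyclic (mgen_ideal (map (mlcm u) L)) i' j
   else True) ->
  koszul_acyclic (mgen_ideal (u :: L)) i j.
Proof.
move=> acL acu acLu k k_i hk kI dk.
pose inL := [pred m | has (fun v => (v <= m)%MM) L].
(* A monomial of [k] outside the ideal of [L] is a multiple of [u], so [k = z1 + z2] with [z1] over
   [L] and [z2] over [u]. *)
pose z1 A : S := mshift 0%MM inL (k A); pose z2 A : S := k A - z1 A.
have z1_i : in_card i z1 by move=> A /k_i kA; rewrite /z1 kA raddf0.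
have z2_i : in_card i z2 by move=> A Ai; rewrite /z2 k_i ?z1_i ?subr0.
have hz1 : homog_family j z1.
  by move=> A; have := homogz_mshift 0%MM inL (hk A); rewrite mdeg0 subr0.
have hz2 : homog_family j z2.
  by move=> A; apply: homogzD => //; apply/homogzN.
have z1L A : mgen_ideal L (z1 A).
  by move=> m; rewrite mcoeff_mshift; case: ifP => //; rewrite eqxx.
have z2u A : mgen_ideal [:: u] (z2 A).
  move=> m; rewrite mcoeffB mcoeff_mshift addm0 /= orbF.
  case: ifPn => [|/negPf mL]; first by rewrite subrr eqxx.
  rewrite subr0 => /kI /=; have -> : has (fun v => (v <= m)%MM) L = false by [].
  by rewrite orbF.
have dz12 A : kz z2 A = - kz z1 A.
  by rewrite kzB dk sub0r.
have dz1I A : mgen_ideal (map (mlcm u) L) (kz z1 A).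
  move=> m nz; have := mgen_ideal_koszul (A := A) z1L nz.
  have: (u <= m)%MM.
    have := @mgen_ideal_koszul _ _ A z2u m.
    by rewrite dz12 mcoeffN oppr_eq0 nz /= orbF; apply.
  move=> um /hasP[v vL vm]; apply/hasP; exists (mlcm u v); first exact: map_f.
  by rewrite lem_mlcm um.
(* The connecting map: the boundary of [z1], up to sign that of [z2], is a cycle over the
   intersection, hence bounds some [w] there. In exterior degree 0 it vanishes and [w = 0] will
   do. *)
have [w [w_i hw wI dw]] : exists w, [/\ in_card i w, homog_family j w,
    forall A, mgen_ideal (map (mlcm u) L) (w A) & forall A, kz z1 A = kz w A].
  case: i acLu z1_i {acL acu k_i z2_i} => [_|i acLu] z1_i.
    exists (fun=> 0); split=> // [A||A].
    - exact: homogz0.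
    - by move=> A; exact: mgen_ideal0.
    - rewrite (koszul_in_card0 (V := S^o)) // (koszul_in_card0 (V := S^o)) //.
  apply: acLu => //.
  - exact: (koszul_in_card (V := S^o)).
  - exact: homog_koszul.
  - by move=> A; exact: (koszul_koszul (V := S^o)).
have wL A : mgen_ideal L (w A).
  move=> m /wI /hasP[_ /mapP[v vL ->]]; rewrite lem_mlcm => /andP[_ vm].
  by apply/hasP; exists v.
have wu A : mgen_ideal [:: u] (w A).
  move=> m /wI /hasP[_ /mapP[v vL ->]]; rewrite lem_mlcm => /andP[um _] /=.
  by rewrite um.
(* [z1 - w] and [z2 + w] are now cycles over [L] and over [u], with sum [k]. *)
have [A|A|A|A|y1 [y1_i hy1 y1I dy1]] := acL (fun A => z1 A - w A).
- by move=> Ai; rewrite z1_i ?w_i ?subr0.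
- by apply: homogzD => //; apply: homogzN.
- by apply: mgen_idealD => //; apply: mgen_idealN.
- by rewrite kzB dw subrr.
have [A|A|A|A|y2 [y2_i hy2 y2I dy2]] := acu (fun A => z2 A + w A).
- by move=> Ai; rewrite z2_i ?w_i ?addr0.
- exact: homogzD.
- exact: mgen_idealD.
- by rewrite kzD dz12 dw addNr.
exists (fun A => y1 A + y2 A); split=> A.
- by move=> Ai; rewrite y1_i ?y2_i ?addr0.
- exact: homogzD.
- apply: mgen_idealD => m.
    by move/y1I => /= ->; rewrite orbT.
  by move/y2I; rewrite /= orbF => ->.
- by rewrite kzD -dy1 -dy2 [z2 A + _]addrC addrA subrK addrC subrK.
Qed.

Definition mlcms s : 'X_{1..n} := foldr (@mlcm n) 0%MM s.

Lemma mlcms_lepP s m : (mlcms s <= m)%MM = all (fun u => (u <= m)%MM) s.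
Proof.
elim: s => [|u s IHs] /=; last by rewrite lem_mlcm IHs.
by apply/mnm_lepP => v; rewrite mnm0E.
Qed.

Lemma lepm_mdeg m1 m2 : (m1 <= m2)%MM -> (mdeg m1 <= mdeg m2)%N.
Proof. by move/mnm_lepP=> le12; rewrite !mdegE; apply: leq_sum. Qed.

(** The induction is on the size of [L], for all [i] at once: the intersection leads to
    [map (mlcm u) L], which is shorter than [u :: L] but no part of it, and to a lower exterior
    degree. *)
Lemma koszul_acyclic_lcm L i j :
  (forall s, size s = i.+1 -> {subset s <= L} -> (mdeg (mlcms s))%:Z < j) ->
  koszul_acyclic (mgen_ideal L) i j.
Proof.
have [N] := ubnP (size L); elim: N L i => // N IHN [|u L] i /= ltLN bound.
  move=> k k_i hk k0 dk; exists (fun=> 0); split=> // A.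
  - exact: homogz0.
  - exact: mgen_ideal0.
  - rewrite [RHS]big1 => [|v _]; last by rewrite scaler0.
    apply/mpolyP => m; rewrite mcoeff0; apply/eqP.
    by apply: contraT => /k0.
have mlcms_lt s1 s2 : size s2 = i.+1 -> {subset s2 <= u :: L} ->
    (mlcms s1 <= mlcms s2)%MM -> (mdeg (mlcms s1))%:Z < j.
  move=> sz sub /lepm_mdeg le12; apply: le_lt_trans (bound _ sz sub).
  by rewrite lez_nat.
apply: koszul_acyclic_cons.
- apply: IHN => // s sz sub; apply: bound => // v /sub.
  by rewrite inE orbC => ->.
(* Sequences may repeat elements, so [u] alone is covered by the bound for [i + 1] copies of it. *)
- apply: koszul_acyclic_principal; rewrite -(mlcm0 u).
  apply: (mlcms_lt [:: u] (nseq i.+1 u)); first exact: size_nseq.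
    by move=> v /nseqP[-> _]; rewrite mem_head.
  by rewrite mlcms_lepP /= lem_mlcml.
case: i IHN bound mlcms_lt => // i IHN bound mlcms_lt.
apply: IHN; first by rewrite size_map.
move=> s sz sub.
have [s' sL def_s] : exists2 s', {subset s' <= L} & s = map (mlcm u) s'.
  elim: s sub {sz} => [|v s IHs] sub; first by exists [::].
  have /mapP[v' v'L ->] := sub v (mem_head _ _).
  have [|s' s'L ->] := IHs; first by move=> w ws; rewrite sub // inE ws orbT.
  by exists (v' :: s') => // w /[!inE] /predU1P[->|/s'L].
(* The lcm of the [i + 1] monomials [mlcm u v] divides that of [u] and the [i + 1] monomials [v],
   which are the [i + 2] that [bound] asks for. *)
rewrite def_s size_map in sz *; apply: (mlcms_lt _ (u :: s')) => /=.
- by rewrite sz.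
- by move=> w /[!inE] /orP[->//|/sL ->]; rewrite orbT.
rewrite mlcms_lepP all_map; apply/allP => v vs /=; rewrite lem_mlcm lem_mlcml /=.
apply: lepm_trans (lem_mlcmr _ _).
by have := lepm_refl (mlcms s'); rewrite mlcms_lepP => /allP; apply.
Qed.

(** The cycle itself is zero: its coefficients lie in [I] and have degree [j - i], which is below
    [c] and possibly negative. *)
Lemma koszul_acyclic_indeg (I : S -> Prop) c i j : I 0 -> is_indeg I c ->
  j < (i + c)%N%:Z -> koszul_acyclic I i j.
Proof.
move=> I0 [_ c_min] lt_j k k_i hk kI dk.
suff k0 A : k A = 0.
  exists (fun=> 0); split=> // A; first exact: homogz0.
  by rewrite k0 /koszul big1 // => v _; rewrite scaler0.
have [Ai|/k_i //] := eqVneq #|A| i.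
apply/eqP; apply: contraT => nz.
have := hk A; rewrite Ai; case def_e: (j - i%:Z) => [e|e] /=; last by rewrite (negPf nz).
move=> hA; have := c_min e; move/(_ (ex_intro _ (k A) _)).
have -> : (c <= e)%N = false.
  by rewrite -lez_nat -def_e lerBrDr -PoszD addnC leNgt lt_j.
by apply; split.
Qed.

End KoszulVanishing.

(** * From Koszul homology to Tor *)

Section KoszulTor.

Variables (K : fieldType) (n : nat).
Local Notation S := {mpoly K[n]}.
Local Notation kz := (@koszul K n S^o).
Implicit Types (A B : {set 'I_n}) (I : S -> Prop) (j : int).

Lemma koszul_entry r (z : {set 'I_n} -> 'rV[S]_r) A a :
  koszul z A 0 a = kz (fun B => z B 0 a) A.
Proof. by rewrite summxE; apply: eq_bigr => v _; rewrite mxE. Qed.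

Lemma koszul_mulmx r r' (z : {set 'I_n} -> 'rV[S]_r) (M : 'M_(r, r')) A :
  koszul z A *m M = koszul (fun B => z B *m M) A.
Proof. exact: (koszul_linear (mulmxr M)). Qed.

Variables (F : graded_free_seq K n) (I : S -> Prop).
Hypothesis resF : is_resolution F I.

Lemma resolution_aug f : I f <-> exists v : 'rV_(frank F 0), f = (v *m faug F) 0 0.
Proof. by case: resF. Qed.

Lemma resolution_exact0 (v : 'rV_(frank F 0)) :
  v *m faug F = 0 <-> exists w, v = w *m fdiff F 0.
Proof. by case: resF => _ /(_ v). Qed.

Lemma resolution_exact p (v : 'rV_(frank F p.+1)) :
  v *m fdiff F p = 0 <-> exists w, v = w *m fdiff F p.+1.
Proof. by case: resF => _ _ /(_ p v). Qed.

Definition homog_rows p j (z : {set 'I_n} -> 'rV[S]_(frank F p)) :=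
  forall A a, homogz (j - #|A|%:Z - fdeg a) (z A 0 a).

(* Zigzag in the double complex [F (x) \Lambda K^n], down to [F_0] where the
   acyclicity of [I (x) \Lambda K^n] is used. *)
Lemma koszul_zigzag j p q (z : {set 'I_n} -> 'rV[S]_(frank F p))
    (x : {set 'I_n} -> 'rV[S]_(frank F p.+1)) :
  koszul_acyclic I (p + q) j -> in_card q z -> homog_rows j z ->
  (forall A, koszul z A = x A *m fdiff F p) ->
  (map_mx (mcoeff 0%MM) (z set0) <= tor_cycles F p)%MS ->
  exists y y', forall A, z A = koszul y A + y' A *m fdiff F p.
Proof.
elim: p q z x => [|p IHp] q z x acI z_q hz dz zT.
  (* The augmentation turns [z] into a Koszul cycle over [I]. A primitive [y] of it lifts to [Y]
     over [F_0], and [z - koszul Y] is then killed by the augmentation. *)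
  pose k A : S := (z A *m faug F) 0 0.
  have [A /z_q zA|A|A|A|y [_ _ yI dy]] := acI k.
  - by rewrite /k zA mul0mx mxE.
  - rewrite /k mxE; apply: homogz_sum => a _.
    by rewrite -(subrK (fdeg a) (_ - _)); apply/homogzM/faug_homog.
  - by apply/resolution_aug; exists (z A).
  - rewrite /k -koszul_entry -koszul_mulmx dz.
    by have /resolution_exact0 -> : exists w, x A *m fdiff F 0 = w *m fdiff F 0;
      [exists (x A) | rewrite mxE].
  have /fin_all_exists[Y YE] A : exists v : 'rV_(frank F 0), y A = (v *m faug F) 0 0.
    exact/resolution_aug.
  suff /fin_all_exists[w wE] A : exists w, z A - koszul Y A = w *m fdiff F 0.
    by exists Y, w => A; rewrite -wE addrC subrK.
  apply/resolution_exact0/rowP => a; rewrite (ord1 a) mulmxBl koszul_mulmx.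
  rewrite mxE [X in _ + X]mxE koszul_entry -/(k A) dy [RHS]mxE.
  by rewrite (eq_koszul (V := S^o) (k' := y)) ?subrr // => B; rewrite -YE.
(* [k] is a Koszul cycle over the free module [F_p]. Contracting each entry gives [z'] one step
   further down, where [z] takes over the role of [x]. *)
pose k A := z A *m fdiff F p.
have dk A : koszul k A = 0.
  rewrite -koszul_mulmx dz; apply/resolution_exact; by exists (x A).
pose z' A := \row_a kcontract (fun B => k B 0 a) A.
have dz' A : koszul z' A = k A.
  apply/rowP => a; rewrite koszul_entry.
  rewrite (eq_koszul (V := S^o) (k' := kcontract (fun B => k B 0 a))) => [|B];
    last by rewrite mxE.
  apply/esym/(@koszul_exact _ _ (fun B => k B 0 a)) => [|B]; last first.
    by rewrite -koszul_entry dk mxE.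
  (* [zT] says precisely that the constant terms of [k set0], the only obstruction, vanish. *)
  have /sub_kermxP : (map_mx (mcoeff 0%MM) (z set0) <= kermx (bar_diff F p))%MS by [].
  by rewrite -map_mxM => /rowP/(_ a); rewrite !mxE.
have [||A a|||y [y' zE]] := IHp q.+1 z' z.
- by rewrite addnS.
- move=> A Aq; apply/rowP => a; rewrite !mxE (kcontract_in_card (i := q)) // => B Bq.
  by rewrite /k z_q // mul0mx mxE.
- rewrite mxE addrAC; apply: (@homog_kcontract _ _ (j - fdeg a)) => B.
  rewrite mxE; apply: homogz_sum => b _.
  have -> : j - fdeg a - #|B|%:Z = (j - #|B|%:Z - fdeg b) + (fdeg b - fdeg a).
    by rewrite addrA subrK addrAC.
  exact/homogzM/fdiff_homog.
- exact: dz'.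
(* [z'] lives in exterior degree [q + 1], so it is zero at the empty set. *)
- have -> : z' set0 = 0; last by rewrite map_mx0 sub0mx.
  apply/rowP => a; rewrite !mxE (kcontract_in_card (i := q)) ?cards0 // => B Bq.
  by rewrite /k z_q // mul0mx mxE.
(* Applying [koszul] to [zE] shows that [z - koszul y'] is killed by [fdiff F p], so it comes from
   [F_(p+2)]. *)
suff /fin_all_exists[w wE] A : exists w, z A - koszul y' A = w *m fdiff F p.+1.
  by exists y', w => A; rewrite -wE addrC subrK.
apply/resolution_exact; rewrite mulmxBl koszul_mulmx -/(k A) -dz'.
by rewrite (eq_koszul _ zE) koszulD koszul_koszul add0r subrr.
Qed.

(** A cycle [v] of degree [j], placed at the empty set as a row of constants, starts the zigzag.
    Koszul boundaries have no constant term, so modulo the variables [v] becomes a boundary. Cycles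
    thus lie among boundaries in degree [j], and the difference of ranks is 0. *)
Lemma tor_dim_acyclic i j : koszul_acyclic I i j -> tor_dim F i j = 0%N.
Proof.
move=> acI; apply/eqP; rewrite subn_eq0; apply/mxrankS/rV_subP => v.
rewrite !sub_capmx => /andP[vT vj]; rewrite vj andbT.
have v0 a : v 0 a != 0 -> fdeg a = j.
  case/submxP: vj => w ->; rewrite mul_mx_diag !mxE.
  by case: (fdeg a =P j) => // _; rewrite mulr0 eqxx.
pose z A : 'rV[S]_(frank F i) := if A == set0 then map_mx (@mpolyC n K) v else 0.
have z_0 : in_card 0 z by move=> A; rewrite cards_eq0 /z => /negPf->.
have zv : map_mx (mcoeff 0%MM) (z set0) = v.
  by rewrite /z eqxx; apply/rowP => a; rewrite !mxE mcoeffC eqxx mulr1.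
have [|//|A a|A||y [y' zE]] := @koszul_zigzag j i 0 z (fun=> 0).
- by rewrite addn0.
- rewrite /z; case: eqP => [->|_]; last by rewrite mxE homogz0.
  rewrite mxE; apply/homogzP => m; rewrite mcoeffC mulf_eq0 negb_or => /andP[/v0 ->].
  by case: (m =P 0%MM) => [-> _|_]; rewrite ?eqxx // mdeg0 cards0 subr0 subrr.
- by rewrite koszul_in_card0 // mul0mx.
- by rewrite zv.
rewrite -zv zE map_mxD map_mxM [X in X + _](_ : _ = 0) ?add0r ?submxMl //.
by apply/rowP => a; rewrite [LHS]mxE /= koszul_const0 mxE.
Qed.

End KoszulTor.

(** * Generators of a monomial ideal and degrees of their lcms *)

Section MonomialGenerators.

Variables (K : fieldType) (n : nat).
Local Notation S := {mpoly K[n]}.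
Implicit Types (I : S -> Prop) (L : seq 'X_{1..n}).

Lemma monomial_spanP (P : 'X_{1..n} -> Prop) (f : S) :
  monomial_span P f -> forall m, f@_m != 0 -> exists2 u, P u & (u <= m)%MM.
Proof.
case=> s [sP ->] m; rewrite raddf_sum /= => nz.
have [/hasP[t ts]|/hasPn t0] := boolP (has (fun t => (t.1 * 'X_[t.2])@_m != 0) s).
  rewrite mulrC mcoeffXM; case: ifP => [le_tm _|]; last by rewrite eqxx.
  by exists t.2; first exact: sP.
by rewrite big_seq big1 ?eqxx // in nz => t /t0; rewrite negbK => /eqP.
Qed.

Lemma generated_by_mgen_ideal I L :
  generated_by I (fun u => u \in L) -> forall f, I f <-> mgen_ideal L f.
Proof.
move=> genI f; split=> [/genI/monomial_spanP fL m /fL[u uL um]|fL].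
  by apply/hasP; exists u.
(* [g m] is the first member of [L] dividing [m]. One exists for [m] in the support of [f], so the
   default [0%MM] is never returned. *)
apply/genI; pose g m := nth 0%MM L (find (fun u => (u <= m)%MM) L).
exists [seq (f@_m *: 'X_[m - g m], g m) | m <- msupp f]; split.
  move=> t /mapP[m]; rewrite mcoeff_msupp => /fL Lm -> /=.
  by rewrite mem_nth // -has_find.
rewrite big_map {1}[f]mpolyE; apply: eq_big_seq => m /=.
rewrite mcoeff_msupp => /fL Lm.
by rewrite -scalerAl -mpolyXD submK // /g;
  exact: (@nth_find _ 0%MM (fun u => (u <= m)%MM)).
Qed.

(** Each square-free generator [a] in [P] is a multiple of some [u] in [L], and a divisor of a
    square-free monomial is square-free. *)
Lemma squarefree_generators I L :
  squarefree_monomial_ideal I -> (forall f, I f <-> mgen_ideal L f) ->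
  forall f, I f <-> mgen_ideal [seq u : 'X_{1..n} <- L | [forall v, (u v <= 1)%N]] f.
Proof.
move=> [P [Psq genP]] IL f; split=> [/genP/monomial_spanP fP m|fL].
  case/fP => a /[dup] Pa /Psq a_sq am.
  have /IL : I 'X_[a].
    by apply/genP; exists [:: (1, a)]; split=> [t /[!inE] /eqP->|];
      rewrite // big_seq1 mul1r.
  move/(_ a); rewrite mcoeffX eqxx oner_eq0 => /(_ isT) /hasP[u uL ua].
  apply/hasP; exists u; last exact: lepm_trans am.
  rewrite mem_filter uL andbT; apply/forallP => v.
  exact: leq_trans (mnm_lepP ua v) (a_sq v).
by apply/IL => m /fL /hasP[u]; rewrite mem_filter => /andP[_ uL] um; apply/hasP; exists u.
Qed.

(** The lcm divides the product. *)
Lemma mdeg_mlcms_le (s : seq 'X_{1..n}) d :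
  {in s, forall u, (mdeg u <= d)%N} -> (mdeg (mlcms s) <= d * size s)%N.
Proof.
elim: s => [|u s IHs] sd; first by rewrite mdeg0.
have le_us : (mlcm u (mlcms s) <= u + mlcms s)%MM.
  by rewrite lem_mlcm lem_addr lem_addl.
rewrite mulnS (leq_trans (lepm_mdeg le_us)) // mdegD leq_add ?sd ?mem_head //.
by apply: IHs => w ws; rewrite sd // inE ws orbT.
Qed.

Lemma mdeg_mlcms_squarefree (s : seq 'X_{1..n}) :
  {in s, forall (u : 'X_{1..n}) v, (u v <= 1)%N} -> (mdeg (mlcms s) <= n)%N.
Proof.
move=> s_sq; have lcm_sq v : (mlcms s v <= 1)%N.
  elim: s s_sq => [|u s IHs] s_sq /=; first by rewrite mnm0E.
  rewrite mnmE geq_max s_sq ?mem_head //=.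
  by apply: IHs => w ws; apply: s_sq; rewrite inE ws orbT.
rewrite mdegE -[leqRHS](card_ord n) -sum1_card; exact: leq_sum.
Qed.

End MonomialGenerators.

Theorem corollary3p7 (K : fieldType) (n : nat)
    (I : {mpoly K[n]} -> Prop)
    (hI : monomial_ideal I) (hI0 : nonzero_ideal I)
    (c : nat) (hc : is_indeg I c)
    (G : seq 'X_{1..n}) (hG : minimal_monomial_generators I G)
    (d : nat) (hd : d = (\max_(u <- G) mdeg u)%N)
    (i : nat) (j : int)
    (beta : nat) (hbeta : is_graded_betti I i j beta) :
  (beta <> 0%N ->
     (i + c)%N%:Z <= j /\ j <= (d * i.+1)%N%:Z) /\
  (squarefree_monomial_ideal I -> beta <> 0%N ->
     (i + c)%N%:Z <= j /\ j <= (minn n (d * i.+1))%N%:Z).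
Proof.
have [F [resF ->]] := hbeta; have [genG _] := hG.
have IG := generated_by_mgen_ideal genG.
have not_acyclic : tor_dim F i j <> 0%N -> ~ koszul_acyclic I i j.
  by move=> nz /(tor_dim_acyclic resF).
(* The generating list is left open: it will be [G] for the bound [d * i.+1] and the square-free
   part of [G] for the bound [n]. *)
have lcm_bound L B : (forall f, I f <-> mgen_ideal L f) -> tor_dim F i j <> 0%N ->
    (forall s, size s = i.+1 -> {subset s <= L} -> (mdeg (mlcms s) <= B)%N) ->
    j <= B%:Z.
  move=> IL /not_acyclic acI sB; rewrite leNgt; apply/negP => lt_Bj; apply: acI.
  apply: (eq_koszul_acyclic IL); apply: koszul_acyclic_lcm => s sz /(sB s sz).
  by rewrite -lez_nat => /le_lt_trans; apply.
have lower : tor_dim F i j <> 0%N -> (i + c)%N%:Z <= j.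
  move=> /not_acyclic acI; rewrite leNgt; apply/negP => lt_j; apply: acI.
  by apply: (koszul_acyclic_indeg _ hc lt_j); apply/IG/mgen_ideal0.
have upper : tor_dim F i j <> 0%N -> j <= (d * i.+1)%N%:Z.
  move=> nz; apply: (lcm_bound G) => // s <- sG; apply: mdeg_mlcms_le => u /sG uG.
  by rewrite hd; apply: leq_bigmax_seq.
split=> [nz|sqI nz]; first by rewrite lower ?upper.
split; first exact: lower.
rewrite /minn; case: ifP => _; last exact: upper.
apply: (lcm_bound _ _ (squarefree_generators sqI IG)) => // s _ sL.
by apply: mdeg_mlcms_squarefree => u /sL; rewrite mem_filter => /andP[/forallP].
Qed.
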